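(* Each of the properties Menger-bounded, Scheepers-bounded, Hurewicz-bounded, and Rothberger-bounded of subsets of $\mathbb{Z}^{\mathbb{N}}$ is preserved under uniformly continuous images: if $X\subseteq\mathbb{Z}^{\mathbb{N}}$ has the property and $\Psi:X\to\mathbb{Z}^{\mathbb{N}}$ is uniformly continuous, then $Y=\Psi[X]$ has the property.
   Context: $\mathbb{N}=\{0,1,2,\dots\}$, $[0,m)=\{0,\dots,m-1\}$, and $\mathbb{Z}^{<\aleph_0}$ is the set of all finite sequences of integers. Uniform continuity is with respect to the metric on $\mathbb{Z}^{\mathbb{N}}$ given by $d(x,x)=0$ and $d(x,y)=1/(N(x,y)+1)$ for $x\ne y$, where $N(x,y)=\min\{n: x(n)\ne y(n)\}$. For an arbitrary subset $X$ of $\mathbb{Z}^{\mathbb{N}}$ the properties are defined as follows. - $X$ is Menger-bounded if there is $f\in\mathbb{N}^{\mathbb{N}}$ such that for every $g\in X$ there are infinitely many $n$ with $|g(k)|\le f(n)$ for all $k\in[0,n)$. - $X$ is Scheepers-bounded if there is $f\in\mathbb{N}^{\mathbb{N}}$ such that for every finite $F\subseteq X$ there are infinitely many $n$ such that $|g(k)|\le f(n)$ for all $g\in F$ and all $k\in[0,n)$. - $X$ is Hurewicz-bounded if there is $f\in\mathbb{N}^{\mathbb{N}}$ such that for every $g\in X$, $|g(n)|\le f(n)$ for all but finitely many $n$. - $X$ is Rothberger-bounded if for each strictly increasing $h\in\mathbb{N}^{\mathbb{N}}$ there is $\varphi:\mathbb{N}\to\mathbb{Z}^{<\aleph_0}$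 such that for every $g\in X$ there exists $n$ such that the restriction $g\upharpoonright[0,h(n))$ equals $\varphi(n)$. *)

(* Defs.v *)
From HB Require Import structures.
From mathcomp Require Import all_boot all_order all_algebra.
From mathcomp Require Import all_classical all_reals all_analysis.

Set Implicit Arguments.
Unset Strict Implicit.
Unset Printing Implicit Defensive.

Import Order.TTheory GRing.Theory Num.Theory.
Local Open Scope classical_set_scope.
Local Open Scope ring_scope.

(* The space Z^N with an R-valued metric. The parameter R only selects the type
   of real numbers in which distances are measured. The alias keeps this metric
   apart from the uniform-convergence structure that the library puts on
   function types. *)
Definition zseq (R : realType) : Type := nat -> int.

HB.instance Definition _ (R : realType) := Choice.copy (zseq R) (nat -> int).

Section metric.
Variable R : realType.
Implicit Types x y z : zseq R.

(* The junk value 0 is taken only when x = y. *)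
Definition first_diff x y : nat :=
  match pselect (exists n, x n != y n) with
  | left ex => ex_minn ex
  | right _ => 0%N
  end.

Definition zseq_dist x y : R :=
  if x == y then 0 else (first_diff x y).+1%:R^-1.

Lemma zseq_neqP x y : x != y -> exists n, x n != y n.
Proof.
move=> /eqP xy; apply: contrapT => /forallNP h; apply: xy; apply/funext => n.
by apply/eqP; move: (h n) => /negP; rewrite negbK.
Qed.

Lemma first_diffP x y : x != y ->
  x (first_diff x y) != y (first_diff x y) /\
  forall n, x n != y n -> (first_diff x y <= n)%N.
Proof.
move=> /zseq_neqP ex; rewrite /first_diff; case: pselect => // ex'.
by case: ex_minnP.
Qed.

Lemma zseq_dist_ge0 x y : 0 <= zseq_dist x y.
Proof. by rewrite /zseq_dist; case: ifP => // _; rewrite invr_ge0. Qed.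

Lemma zseq_dist_ge x y n : x n != y n -> n.+1%:R^-1 <= zseq_dist x y.
Proof.
move=> xyn; rewrite /zseq_dist; case: eqVneq => [xy|xy].
  by rewrite xy eqxx in xyn.
by rewrite lef_pV2 ?posrE// ler_nat ltnS; apply: (first_diffP xy).2.
Qed.

Lemma zseq_distxx x : zseq_dist x x = 0.
Proof. by rewrite /zseq_dist eqxx. Qed.

Lemma zseq_dist_positivity x y : zseq_dist x y = 0 -> x = y.
Proof.
rewrite /zseq_dist; case: eqP => // _ /eqP.
by rewrite invr_eq0 pnatr_eq0.
Qed.

Lemma zseq_dist_sym x y : zseq_dist x y = zseq_dist y x.
Proof.
suff le u v : zseq_dist u v <= zseq_dist v u by apply/eqP; rewrite eq_le !le.
rewrite {1}/zseq_dist; case: eqVneq => [_|uv]; first exact: zseq_dist_ge0.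
by apply: zseq_dist_ge; rewrite eq_sym; exact: (first_diffP uv).1.
Qed.

Lemma zseq_dist_triangle y x z :
  zseq_dist x z <= zseq_dist x y + zseq_dist y z.
Proof.
rewrite {1}/zseq_dist; case: eqVneq => [_|xz].
  by rewrite addr_ge0 ?zseq_dist_ge0.
have [xzn _] := first_diffP xz; set n := first_diff x z in xzn *.
have [xyn|xyn] := eqVneq (x n) (y n).
  by rewrite ler_wpDl ?zseq_dist_ge0//; apply: zseq_dist_ge; rewrite -xyn.
by rewrite ler_wpDr ?zseq_dist_ge0//; exact: zseq_dist_ge.
Qed.

End metric.

HB.instance Definition _ (R : realType) := isMetric.Build R (zseq R)
  (@zseq_distxx R) (@zseq_dist_positivity R) (@zseq_dist_sym R)
  (@zseq_dist_triangle R).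

Lemma zseq_unif_continuousP (R : realType) (X : set (zseq R))
    (Psi : X -> zseq R) :
  unif_continuous Psi <->
  forall e : R, 0 < e -> exists2 d : R, 0 < d & forall x y : X,
    zseq_dist (val x) (val y) < d -> zseq_dist (Psi x) (Psi y) < e.
Proof.
rewrite (@unif_continuousP R X (zseq R) Psi).
split=> h e e0; have [d d0 H] := h e e0; exists d => //.
- by move=> x y xy; exact: (H (x, y) xy).
- by move=> -[x y] xy; exact: (H x y xy).
Qed.

Definition menger_bounded (X : set (nat -> int)) : Prop :=
  exists f : nat -> nat, forall g, X g ->
    infinite_set [set n | forall k, (k < n)%N -> (`|g k| <= f n)%N].

Definition scheepers_bounded (X : set (nat -> int)) : Prop :=
  exists f : nat -> nat, forall F : set (nat -> int),
    finite_set F -> F `<=` X ->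
    infinite_set
      [set n | forall g, F g -> forall k, (k < n)%N -> (`|g k| <= f n)%N].

Definition hurewicz_bounded (X : set (nat -> int)) : Prop :=
  exists f : nat -> nat, forall g, X g ->
    cofinite_set [set n | (`|g n| <= f n)%N].

(* mkseq g m is the restriction of g to [0, m). *)
Definition rothberger_bounded (X : set (nat -> int)) : Prop :=
  forall h : nat -> nat, {homo h : m n / (m < n)%N} ->
    exists phi : nat -> seq int, forall g, X g ->
      exists n, mkseq g (h n) = phi n.

(* Main.v *)
Require Import Defs.
From mathcomp Require Import all_boot all_order all_algebra.
From mathcomp Require Import all_classical all_reals all_analysis.
From mathcomp Require Import zify.

Import Order.TTheory GRing.Theory Num.Theory.

(** Uniform continuity provides a strictly increasing [m] such that the first
    [m n] terms of [x] determine the first [n] terms of [Psi x]. As only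
    finitely many integer sequences of length [m n] are bounded by [c], the
    terms [Psi x k] with [k < n] are bounded uniformly over all [x] in [X] that
    are bounded by [c] on [[0, m n)]. So bounds on [X] give bounds on the image;
    for Rothberger-boundedness, guesses of [x] on [[0, m (h n))] give guesses of
    [Psi x] on [[0, h n)]. *)

Local Open Scope classical_set_scope.

Definition modulus {R : realType} {X : set (zseq R)} (Psi : X -> zseq R)
    (m : nat -> nat) : Prop :=
  forall n (x y : X), (forall i, (i < m n)%N -> val x i = val y i) ->
    forall k, (k < n)%N -> Psi x k = Psi y k.

Lemma infinite_nat_unbounded (A : set nat) :
  infinite_set A <-> forall N, exists2 n, (N <= n)%N & A n.
Proof.
split=> [infA N|unbA finA].
  apply: contrapT => nA; apply: infA; apply: (sub_finite_set _ (finite_II N)).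
  by move=> n An /=; rewrite ltnNge; apply/negP => Nn; apply: nA; exists n.
have [N AN] : exists N, forall n, A n -> (n < N)%N.
  have [s sA] := (finite_seqP _).1 finA.
  exists (\max_(i <- s) i).+1 => n; rewrite sA ltnS => ns.
  exact: (@leq_bigmax_seq _ s xpredT id).
by have [n Nn /AN] := unbA N; rewrite ltnNge Nn.
Qed.

Lemma leq_max_ord (f : nat -> nat) n i : (i < n)%N ->
  (f i <= \max_(j < n) f j)%N.
Proof. by move=> lt_in; exact: (leq_bigmax (Ordinal lt_in)). Qed.

Lemma zseq_dist_le (R : realType) (x y : zseq R) n :
  (forall i, (i < n)%N -> x i = y i) ->
  (zseq_dist x y <= n.+1%:R^-1)%R.
Proof.
move=> xy; rewrite /zseq_dist; case: eqVneq => [_|xDy].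
  by rewrite invr_ge0.
rewrite lef_pV2 ?posrE// ler_nat ltnS leqNgt; apply/negP => /xy.
by apply/eqP; exact: (first_diffP xDy).1.
Qed.

Section image.
Context {R : realType} {X : set (zseq R)} {Psi : X -> zseq R}.

Lemma unif_continuous_modulus : unif_continuous Psi ->
  exists2 m, modulus Psi m & {homo m : i j / (i < j)%N}.
Proof.
move=> /zseq_unif_continuousP ucPsi.
have /choice[m0 m0P] n : exists m0, forall x y : X,
    (forall i, (i < m0)%N -> val x i = val y i) ->
    forall k, (k < n)%N -> Psi x k = Psi y k.
  have [|d d0 dP] := ucPsi n.+1%:R^-1%R; first by rewrite invr_gt0.
  have [p pd] : exists p : nat, (p.+1%:R^-1 < d)%R.
    exists (Num.truncn d^-1); rewrite invf_plt ?posrE//.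
    exact: truncnS_gt.
  (* Agreement below [p] puts [x] and [y] closer than [d], hence their images closer than [1/(n+1)];
     a difference at [k < n] would keep the images at least [1/(k+1)] apart. *)
  exists p => x y /zseq_dist_le xy k kn; apply/eqP; apply: contraT => Dk.
  have := le_lt_trans (zseq_dist_ge Dk) (dP x y (le_lt_trans xy pd)).
  by rewrite ltf_pV2 ?posrE// ltr_nat ltnS ltnNge (ltnW kn).
(* The sum dominates [m0 n], and the summand [n] makes the growth strict. *)
exists (fun n => n + \sum_(i < n.+1) m0 i)%N.
  move=> n x y xy; apply: m0P => i im0; apply: xy.
  by rewrite (leq_trans im0)// big_ord_recr/= addnA leq_addl.
apply: homo_ltn => [|n]; first exact: ltn_trans.
by rewrite addSn ltnS [X in (_ <= _ + X)%N]big_ord_recr/= leq_add2l leq_addr.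
Qed.

Context {m : nat -> nat} (mP : modulus Psi m).

Lemma modulus_bound n c : exists B, forall x : X,
  (forall i, (i < m n)%N -> (`|val x i| <= c)%N) ->
  forall k, (k < n)%N -> (`|Psi x k| <= B)%N.
Proof.
pose bnd (x : X) := forall i, (i < m n)%N -> (`|val x i| <= c)%N.
(* Shifting by [c] sends [[-c, c]] to [[0, 2c]], so [inord] loses nothing on the points satisfying
   [bnd]. *)
pose code (x : X) : {ffun 'I_(m n) -> 'I_(c + c).+1} :=
  [ffun i : 'I_(m n) => inord `|(val x i + c%:Z)%R|].
have code_inj (x y : X) : bnd x -> bnd y -> code x = code y ->
    forall i, (i < m n)%N -> val x i = val y i.
  move=> xb yb /ffunP exy i im.
  move: (xb _ im) (yb _ im) (exy (Ordinal im)); rewrite !ffunE/=.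
  move: (sval x i) (sval y i) => u v uc vc /(congr1 val)/=.
  by rewrite !inordK; lia.
(* Points of [bnd] with a common code have the same first [n] image terms, so one representative [y]
   yields the bound for its code. *)
have /choice[b bP] t : exists b, forall x : X, bnd x -> code x = t ->
    forall k, (k < n)%N -> (`|Psi x k| <= b)%N.
  have [[y [yb yt]]|nex] := pselect (exists y : X, bnd y /\ code y = t).
    exists (\max_(k < n) `|Psi y k|)%N => x bx xt k kn.
    rewrite (mP _ _ y (code_inj _ _ bx yb _) _ kn) ?xt//.
    exact: (leq_max_ord (fun k => `|Psi y k|%N)).
  by exists 0%N => x bx xt; case: nex; exists x.
exists (\max_t b t)%N => x bx k kn.
exact: leq_trans (bP _ x bx erefl k kn) (leq_bigmax _).
Qed.

Context (m_mono : {homo m : i j / (i < j)%N}).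

Lemma modulus_ge n : (n <= m n)%N.
Proof.
by elim: n => // n IHn; exact: leq_ltn_trans IHn (m_mono _ _ (ltnSn n)).
Qed.

(** Take the largest [p] with [m p <= n]; it exists because [p <= m p]. *)
Lemma modulus_bracket N n : (m N <= n)%N ->
  exists2 p, (N <= p)%N & (m p <= n < m p.+1)%N.
Proof.
move=> mNn; have bound p : (m p <= n)%N -> (p <= n)%N.
  exact: leq_trans (modulus_ge p).
have [p mpn pmax] := ex_maxnP (ex_intro (fun p => m p <= n)%N N mNn) bound.
exists p; first exact: pmax.
by rewrite mpn ltnNge; apply/negP => /pmax; rewrite ltnn.
Qed.

(* A good [n] for [X] with [m p <= n < m p.+1] makes [p] good for the image. *)
Lemma infinitely_often_bounded_image (f : nat -> nat) :
  exists f' : nat -> nat, forall G : set X,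
    infinite_set [set n | forall x, G x ->
      forall k, (k < n)%N -> (`|val x k| <= f n)%N] ->
    infinite_set [set n | forall g, (Psi @` G) g ->
      forall k, (k < n)%N -> (`|g k| <= f' n)%N].
Proof.
(* The maximum covers every [n] in the bracket of [p], since the good one depends on [G]. *)
have /choice[f' f'P] p := modulus_bound p (\max_(n < m p.+1) f n).
exists f' => G /infinite_nat_unbounded infG.
apply/infinite_nat_unbounded => N.
have [n /modulus_bracket[p Np /andP[mpn nmp]] Gn] := infG (m N).
exists p => // _ [x Gx <-]; apply: f'P => i imp.
exact: leq_trans (Gn x Gx i (leq_trans imp mpn)) (leq_max_ord f _ _ nmp).
Qed.

Lemma menger_bounded_image : menger_bounded X -> menger_bounded (range Psi).
Proof.
move=> [f fP]; have [f' f'P] := infinitely_often_bounded_image f.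
exists f' => _ [x _ <-].
(* Menger-boundedness is the case of a singleton [G]. *)
have /f'P : infinite_set [set n | forall y, [set x] y ->
    forall k, (k < n)%N -> (`|val y k| <= f n)%N].
  by apply: sub_infinite_set (fP _ (set_valP x)) => n xn _ ->.
by apply: sub_infinite_set => n; apply; exists x.
Qed.

Lemma scheepers_bounded_image :
  scheepers_bounded X -> scheepers_bounded (range Psi).
Proof.
move=> [f fP]; have [f' f'P] := infinitely_often_bounded_image f.
exists f' => F finF FPsi.
(* [s] picks preimages of the elements of [F]. Its values lie in [zseq R] so that a default exists
   outside [F] even when [X] is empty. *)
have /choice[s sP] g : exists z : zseq R, F g ->
    exists2 x : X, val x = z & Psi x = g.
  have [/FPsi[x _ xg]|nFg] := pselect (F g).
    by exists (val x) => _; exists x.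
  by exists (fun=> 0%R).
have sX : s @` F `<=` X.
  by move=> _ [g /sP[x <- _] <-]; exact: set_valP.
have /f'P : infinite_set [set n | forall x : X, (s @` F) (val x) ->
    forall k, (k < n)%N -> (`|val x k| <= f n)%N].
  apply: sub_infinite_set (fP _ (finite_image _ finF) sX).
  by move=> n sn x; exact: sn.
apply: sub_infinite_set => n Pn g Fg; apply: Pn.
by have [x xs xg] := sP g Fg; exists x => //; exists g.
Qed.

Lemma hurewicz_bounded_image :
  hurewicz_bounded X -> hurewicz_bounded (range Psi).
Proof.
move=> [f fP].
(* The length [n.+1] makes the term at [n] itself controlled. The summand [n] absorbs the finitely
   many [i] with [|x i| > f i], as soon as [n] reaches the maximum [c] of [|x i|] over them. *)
have /choice[f' f'P] n := modulus_bound n.+1 (n + \max_(i < m n.+1) f i).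
exists f' => _ [x _ <-].
have [s sP] := (finite_seqP _).1 (fP _ (set_valP x)).
pose c := (\max_(i <- s) `|val x i|)%N.
apply: (sub_finite_set _ (finite_II c)) => n /= nb; rewrite ltnNge.
apply/negP => cn; apply: nb; apply: (f'P n x) => // i im.
have [|] := leqP `|val x i| (f i).
  move=> /leq_trans; apply.
  by rewrite (leq_trans (leq_max_ord f _ _ im))// leq_addl.
rewrite ltnNge => /negP xi.
have si : i \in s by have := congr1 (@^~ i) sP => /= <-.
rewrite (leq_trans _ (leq_addr _ _))// (leq_trans _ cn)//.
exact: (@leq_bigmax_seq _ s xpredT (fun i => `|val x i|%N)).
Qed.

Lemma rothberger_bounded_image :
  rothberger_bounded X -> rothberger_bounded (range Psi).
Proof.
move=> rX h h_mono.
have [|phi phiP] := rX (m \o h); first by move=> i j ij; exact/m_mono/h_mono.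
(* The guess for the image is read off any [y] in [X] that extends [phi n]; the modulus makes it
   independent of [y]. With no such [y], any value will do. *)
have /choice[psi psiP] n : exists s, forall x : X,
    mkseq (val x) (m (h n)) = phi n -> mkseq (Psi x) (h n) = s.
  have [[y yn]|nex] :=
      pselect (exists y : X, mkseq (val y) (m (h n)) = phi n).
    exists (mkseq (Psi y) (h n)) => x xn.
    apply/(@eq_from_nth _ 0%R); rewrite !size_mkseq// => k kn.
    rewrite !nth_mkseq//; apply: mP kn => i im.
    by rewrite -(nth_mkseq 0%R (val x) im) xn -yn nth_mkseq.
  by exists [::] => x xn; case: nex; exists x.
exists psi => _ [x _ <-]; have [n xn] := phiP _ (set_valP x).
by exists n; exact: psiP.
Qed.

End image.

(* The subset X, seen as a type, carries the uniform structure induced by the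
   metric of zseq R. *)
Theorem lemma5p2 (R : realType) (X : set (zseq R)) (Psi : X -> zseq R)
  (ucPsi : unif_continuous Psi) :
  [/\ menger_bounded X -> menger_bounded (range Psi),
      scheepers_bounded X -> scheepers_bounded (range Psi),
      hurewicz_bounded X -> hurewicz_bounded (range Psi) &
      rothberger_bounded X -> rothberger_bounded (range Psi)].
Proof.
have [m mP m_mono] := unif_continuous_modulus ucPsi.
split.
- exact: (menger_bounded_image mP m_mono).
- exact: (scheepers_bounded_image mP m_mono).
- exact: (hurewicz_bounded_image mP).
- exact: (rothberger_bounded_image mP m_mono).
Qed.
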